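(* Let $\mathcal{H}_A\cong\mathcal{H}_B\cong\mathcal{H}_C\cong\mathbb{C}^2$ and let $\rho_{ABC}=|\psi\rangle\langle\psi|$ be a pure state, where $|\psi\rangle\in\mathcal{H}_A\otimes\mathcal{H}_B\otimes\mathcal{H}_C$ is a unit vector. Then $\rho_{ABC}$ is triangle-compatible if and only if $|\psi\rangle$ factorizes across some bipartition, i.e. $|\psi\rangle$ is a product vector with respect to at least one of the bipartitions $A|BC$, $B|AC$, $C|AB$.
   Context: All Hilbert spaces are finite-dimensional complex Hilbert spaces; a state is a positive semidefinite operator of unit trace; a quantum channel is a completely positive trace-preserving linear map between operator spaces. A state $\rho_{ABC}$ on $\mathcal{H}_A\otimes\mathcal{H}_B\otimes\mathcal{H}_C$ is triangle-compatible if there exist finite-dimensional Hilbert spaces (of arbitrary dimension) $\mathcal{H}_{L^{(A)}},\mathcal{H}_{L^{(C)}},\mathcal{H}_{M^{(A)}},\mathcal{H}_{M^{(B)}},\mathcal{H}_{N^{(B)}},\mathcal{H}_{N^{(C)}}$, states $\varrho_{L^{(A)}L^{(C)}}$, $\varrho_{M^{(A)}M^{(B)}}$, $\varrho_{N^{(B)}N^{(C)}}$ on the corresponding tensor products, and quantum channels $\mathcal{E}_A$ from operators on $\mathcal{H}_{L^{(A)}}\otimes\mathcal{H}_{M^{(A)}}$ to operators on $\mathcal{H}_A$, $\mathcal{E}_B$ from operators on $\mathcal{H}_{M^{(B)}}\otimes\mathcal{H}_{N^{(B)}}$ to operators on $\mathcal{H}_B$, and $\mathcal{E}_C$ from operators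 on $\mathcal{H}_{L^{(C)}}\otimes\mathcal{H}_{N^{(C)}}$ to operators on $\mathcal{H}_C$, such that (after the obvious reordering of tensor factors) $$\rho_{ABC}=(\mathcal{E}_A\otimes\mathcal{E}_B\otimes\mathcal{E}_C)\big(\varrho_{L^{(A)}L^{(C)}}\otimes\varrho_{M^{(A)}M^{(B)}}\otimes\varrho_{N^{(B)}N^{(C)}}\big).$$ *)

(* Defs.v *)
From mathcomp Require Import all_boot all_order all_algebra.
From mathcomp Require Export all_reals complex mxtens.

Set Implicit Arguments.
Unset Strict Implicit.
Unset Printing Implicit Defensive.

Import Order.TTheory GRing.Theory Num.Theory.
Local Open Scope ring_scope.
Local Open Scope sesquilinear_scope.

(* A Hilbert space of dimension n is C^n with its standard inner product, and
   operators on it are n x n matrices.  The tensor product of C^m and C^n is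
   C^(m * n), with basis vector e_i (x) e_j at [mxtens_index (i, j)]; products
   of more than two factors associate as written. *)

Section TriangleNetwork.

Variable C : numClosedFieldType.

(* The order on C satisfies 0 <= z iff z is real and nonnegative, so over the
   complex numbers this includes hermiticity. *)
Definition psdmx n (A : 'M[C]_n) : Prop :=
  forall v : 'cV[C]_n, 0 <= (v^t* *m A *m v) 0 0.

Definition is_state n (rho : 'M[C]_n) : Prop := psdmx rho /\ \tr rho = 1.

Definition unit_vector n (v : 'cV[C]_n) : Prop := v^t* *m v = 1%:M.

(* |v><v| *)
Definition ketbra n (v : 'cV[C]_n) : 'M[C]_n := v *m v^t*.

(* Defined through the expansion of X on the basis e_ij (x) e_kl; for linear E
   and F it is the linear map determined by [tens_map_tens] below. *)
Definition tens_map m1 n1 m2 n2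
    (E : 'M[C]_m1 -> 'M[C]_n1) (F : 'M[C]_m2 -> 'M[C]_n2)
    (X : 'M[C]_(m1 * m2)) : 'M[C]_(n1 * n2) :=
  \sum_(i < m1) \sum_(j < m1) \sum_(k < m2) \sum_(l < m2)
    X (mxtens_index (i, k)) (mxtens_index (j, l))
      *: (E (delta_mx i j) *t F (delta_mx k l)).

Lemma tens_map_tens m1 n1 m2 n2
    (E : {linear 'M[C]_m1 -> 'M[C]_n1}) (F : {linear 'M[C]_m2 -> 'M[C]_n2})
    (A : 'M[C]_m1) (B : 'M[C]_m2) :
  tens_map E F (A *t B) = E A *t F B.
Proof.
rewrite [in RHS](matrix_sum_delta A) [in RHS](matrix_sum_delta B) !linear_sum.
apply/matrixP => r s; rewrite /tens_map !mxE !summxE mulr_suml.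
apply: eq_bigr => i _; rewrite !linear_sum !summxE mulr_suml.
apply: eq_bigr => j _; rewrite mulr_sumr summxE.
apply: eq_bigr => k _; rewrite linear_sum !summxE mulr_sumr.
apply: eq_bigr => l _.
by rewrite !linearZ !mxE !mxtens_indexK /= mulrACA.
Qed.

Lemma tens_map_linear m1 n1 m2 n2
    (E : 'M[C]_m1 -> 'M[C]_n1) (F : 'M[C]_m2 -> 'M[C]_n2) :
  linear (tens_map E F).
Proof.
move=> a X Y; rewrite /tens_map.
rewrite scaler_sumr -big_split /=; apply: eq_bigr => i _.
rewrite scaler_sumr -big_split /=; apply: eq_bigr => j _.
rewrite scaler_sumr -big_split /=; apply: eq_bigr => k _.
rewrite scaler_sumr -big_split /=; apply: eq_bigr => l _.
by rewrite !mxE scalerDl scalerA.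
Qed.

Definition completely_positive m n (E : 'M[C]_m -> 'M[C]_n) : Prop :=
  forall (k : nat) (X : 'M[C]_(k * m)),
    psdmx X -> psdmx (tens_map (fun Y : 'M[C]_k => Y) E X).

Definition trace_preserving m n (E : 'M[C]_m -> 'M[C]_n) : Prop :=
  forall X : 'M[C]_m, \tr (E X) = \tr X.

Definition is_channel m n (E : {linear 'M[C]_m -> 'M[C]_n}) : Prop :=
  completely_positive E /\ trace_preserving E.

(* Sends the basis index of (LA (x) MA) (x) (MB (x) NB) (x) (LC (x) NC), sorted
   by receiving party, to the corresponding basis index of
   (LA (x) LC) (x) (MA (x) MB) (x) (NB (x) NC), sorted by source. *)
Definition source_index lA lC mA mB nB nC
    (x : 'I_((lA * mA) * (mB * nB) * (lC * nC))) :
    'I_((lA * lC) * (mA * mB) * (nB * nC)) :=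
  let: (ab, c) := mxtens_unindex x in
  let: (a, b) := mxtens_unindex ab in
  let: (la, ma) := mxtens_unindex a in
  let: (mb, nb) := mxtens_unindex b in
  let: (lc, nc) := mxtens_unindex c in
  mxtens_index (mxtens_index (mxtens_index (la, lc), mxtens_index (ma, mb)),
                mxtens_index (nb, nc)).

Definition sort_by_party lA lC mA mB nB nC
    (X : 'M[C]_((lA * lC) * (mA * mB) * (nB * nC))) :
    'M[C]_((lA * mA) * (mB * nB) * (lC * nC)) :=
  mxsub (@source_index lA lC mA mB nB nC) (@source_index lA lC mA mB nB nC) X.

Definition triangle_compatible a b c (rho : 'M[C]_(a * b * c)) : Prop :=
  exists (lA lC mA mB nB nC : nat)
    (rhoL : 'M[C]_(lA * lC)) (rhoM : 'M[C]_(mA * mB)) (rhoN : 'M[C]_(nB * nC))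
    (EA : {linear 'M[C]_(lA * mA) -> 'M[C]_a})
    (EB : {linear 'M[C]_(mB * nB) -> 'M[C]_b})
    (EC : {linear 'M[C]_(lC * nC) -> 'M[C]_c}),
    [/\ is_state rhoL, is_state rhoM & is_state rhoN] /\
    [/\ is_channel EA, is_channel EB & is_channel EC] /\
    rho = tens_map (tens_map EA EB) EC (sort_by_party (rhoL *t rhoM *t rhoN)).

Definition product_A_BC a b c (psi : 'cV[C]_(a * b * c)) : Prop :=
  exists (u : 'cV[C]_a) (w : 'cV[C]_(b * c)), forall i j k,
    psi (mxtens_index (mxtens_index (i, j), k)) 0
    = u i 0 * w (mxtens_index (j, k)) 0.

Definition product_B_AC a b c (psi : 'cV[C]_(a * b * c)) : Prop :=
  exists (u : 'cV[C]_b) (w : 'cV[C]_(a * c)), forall i j k,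
    psi (mxtens_index (mxtens_index (i, j), k)) 0
    = u j 0 * w (mxtens_index (i, k)) 0.

Definition product_C_AB a b c (psi : 'cV[C]_(a * b * c)) : Prop :=
  exists (u : 'cV[C]_c) (w : 'cV[C]_(a * b)), forall i j k,
    psi (mxtens_index (mxtens_index (i, j), k)) 0
    = u k 0 * w (mxtens_index (i, j)) 0.

End TriangleNetwork.

(* Main.v *)
(* Write Xh for the Heisenberg dual of an observable X under the channel of its
   party, and sigma for the product of the three sources.  If a pure output psi
   satisfies X_A psi = Z_C psi, the Kadison-Schwarz inequality bounds
   tr (W^* W sigma) by 0 for W = Xh_A - Zh_C, so Xh_A and Zh_C act in the same
   way on sigma; since no source feeds A, B and C at once, Xh_A is then
   uncorrelated with every observable of B.  If moreover X_A psi = Y_B psi, this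
   reads |X_A psi|^2 = |<psi, X_A psi>|^2, so psi is an eigenvector of X_A.

   Every three-qubit vector admits such a triple: take for X, Y, Z the traceless
   matrices representing the three quadratic forms det (x_0 f_0 + x_1 f_1) in
   its slices along A, B, C.  If psi is an eigenvector of X_A, either X is not
   scalar and psi factorizes across A|BC, or X = 0 and the pencil of slices is
   singular, which makes psi factorize across B|AC or C|AB. *)
Require Import Defs.
From HB Require Import structures.
From mathcomp Require Import all_boot all_order all_algebra.
From mathcomp Require Import ring.
Import Order.TTheory GRing.Theory Num.Theory.
Local Open Scope ring_scope.
Local Open Scope sesquilinear_scope.

Set Implicit Arguments.
Unset Strict Implicit.
Unset Printing Implicit Defensive.

Section PureTriangle.

Variable C : numClosedFieldType.

(** * Positive semidefinite matrices *)

Lemma adjmxM m n p (A : 'M[C]_(m, n)) (B : 'M[C]_(n, p)) :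
  (A *m B)^t* = B^t* *m A^t*.
Proof. by rewrite trmx_mul map_mxM. Qed.

Lemma adjmxD m n (A B : 'M[C]_(m, n)) : (A + B)^t* = A^t* + B^t*.
Proof. by rewrite linearD map_mxD. Qed.

Lemma adjmxZ m n a (A : 'M[C]_(m, n)) : (a *: A)^t* = a^* *: A^t*.
Proof. by rewrite linearZ map_mxZ. Qed.

Lemma adjmxB m n (A B : 'M[C]_(m, n)) : (A - B)^t* = A^t* - B^t*.
Proof. by rewrite linearB map_mxB. Qed.

Lemma adjmx1 n : (1%:M : 'M[C]_n)^t* = 1%:M.
Proof. by rewrite trmx1 map_mx1. Qed.

Lemma adjmx_delta m n (i : 'I_m) (j : 'I_n) :
  (delta_mx i j : 'M[C]_(m, n))^t* = delta_mx j i.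
Proof. by rewrite trmx_delta map_delta_mx. Qed.

Lemma adjmx_tens m n p q (A : 'M[C]_(m, n)) (B : 'M[C]_(p, q)) :
  (A *t B)^t* = A^t* *t B^t*.
Proof. by rewrite trmx_tens map_mxT. Qed.

Lemma mxtrace_adj n (A : 'M[C]_n) : \tr (A^t*) = (\tr A)^*.
Proof. by rewrite /mxtrace rmorph_sum; apply: eq_bigr => i _; rewrite !mxE. Qed.

Lemma mxtrace_tens m n (A : 'M[C]_m) (B : 'M[C]_n) :
  \tr (A *t B) = \tr A * \tr B.
Proof. by rewrite /mxtrace mulr_sum; apply: eq_bigr => i _; rewrite mxE. Qed.

Lemma psdmx_gram m n (F : 'M[C]_(m, n)) : psdmx (F^t* *m F).
Proof.
move=> v; rewrite mulmxA -adjmxM -mulmxA mxE sumr_ge0 // => i _.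
by rewrite !mxE mulrC mul_conjC_ge0.
Qed.

Lemma gram_trace_ge0 m n (F : 'M[C]_(m, n)) : 0 <= \tr (F *m F^t*).
Proof.
apply: sumr_ge0 => i _; rewrite mxE; apply: sumr_ge0 => j _.
by rewrite !mxE mul_conjC_ge0.
Qed.

Lemma gram_trace_eq0 m n (F : 'M[C]_(m, n)) : \tr (F *m F^t*) = 0 -> F = 0.
Proof.
have pos i j : 0 <= F i j * (F^t*) j i by rewrite !mxE mul_conjC_ge0.
move=> F0; apply/matrixP => i j; rewrite mxE.
move/eqP: F0; rewrite /mxtrace psumr_eq0 => [/allP/(_ i)|k _]; last first.
  by rewrite mxE sumr_ge0.
rewrite mem_index_enum mxE psumr_eq0 // => /(_ isT)/allP/(_ j).
by rewrite mem_index_enum !mxE mul_conjC_eq0 => /(_ isT)/eqP.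
Qed.

(** Polarization: the form [f] takes real values at [u + v] and at [u + 'i v], and these two facts
    determine the conjugate of [f v u]. *)
Lemma psdmx_herm n (A : 'M[C]_n) : psdmx A -> A^t* = A.
Proof.
move=> psdA.
pose f (u v : 'cV[C]_n) : C := (u^t* *m A *m v) 0 0.
have real u : (f u u)^* = f u u by apply/CrealP/ger0_real/psdA.
have fD (u v w x : 'cV[C]_n) (c : C) : f (u + c *: v) (w + c *: x)
    = f u w + c * f u x + c^* * f v w + c^* * c * f v x.
  rewrite /f adjmxD adjmxZ !mulmxDl !mulmxDr -!scalemxAr -!scalemxAl !mxE.
  ring.
have sym u v : (f v u)^* = f u v.
  have := real (u + 1 *: v); have := real (u + 'i *: v).
  rewrite !fD !conjCi !rmorphD !rmorphM !rmorphN !rmorph1 /= !real ?conjCi.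
  move=> /eqP; rewrite -subr_eq0 => /eqP e1 /eqP; rewrite -subr_eq0 => /eqP e2.
  have i2 : 2 * 'i != 0 :> C by rewrite mulf_neq0 ?pnatr_eq0 ?neq0Ci.
  apply: (mulfI i2); rewrite -[RHS]addr0 -e1.
  rewrite -[RHS]addr0 -[in RHS](mulr0 'i) -e2.
  ring.
have entry i j : A i j = f (delta_mx i 0) (delta_mx j 0).
  by rewrite /f adjmx_delta -rowE -colE !mxE.
by apply/matrixP => i j; rewrite !mxE !entry sym.
Qed.


(** By the spectral theorem [A] is unitarily diagonal, and [F] is the square root of the diagonal
    part times the unitary. *)
Lemma psdmxP n (A : 'M[C]_n) : psdmx A -> exists F : 'M[C]_n, A = F^t* *m F.
Proof.
move=> psdA; set P := spectralmx A; set d := spectral_diag A.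
have Pu : P \is unitarymx := spectral_unitarymx A.
have Adec : A = P^t* *m diag_mx d *m P.
  rewrite -(invmx_unitary Pu); apply/orthomx_spectralP/hermitian_normalmx.
  by apply/is_hermitianmxP; rewrite expr0 scale1r psdmx_herm.
(* An eigenvalue is the value of the quadratic form at its eigenvector, the conjugate of row [i] of
   [P]. *)
have d_ge0 i : 0 <= d 0 i.
  have := psdA ((row i P)^t*); rewrite trmxCK {1}Adec rowE adjmxM adjmx_delta.
  by rewrite !mulmxA !mulmxtVK // -rowE -colE !mxE eqxx.
exists (diag_mx (map_mx sqrtC d) *m P).
rewrite {1}Adec adjmxM -!mulmxA; congr (_ *m _); rewrite !mulmxA; congr (_ *m _).
rewrite tr_diag_mx map_diag_mx mulmx_diag; congr diag_mx.
apply/rowP => i; rewrite !mxE /= geC0_conj ?sqrtC_ge0 //.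
by rewrite -expr2 sqrtCK.
Qed.

Lemma psdmx_tens m n (A : 'M[C]_m) (B : 'M[C]_n) :
  psdmx A -> psdmx B -> psdmx (A *t B).
Proof.
move=> /psdmxP[F ->] /psdmxP[G ->].
by rewrite -tensmx_mul -adjmx_tens; apply: psdmx_gram.
Qed.

Lemma psdmx_conj m n (V : 'M[C]_(m, n)) (A : 'M[C]_n) :
  psdmx A -> psdmx (V *m A *m V^t*).
Proof.
move=> /psdmxP[F ->]; have := psdmx_gram (F *m V^t*).
by rewrite adjmxM trmxCK !mulmxA.
Qed.

Lemma psdmx_trace_mul_ge0 n (A B : 'M[C]_n) :
  psdmx A -> psdmx B -> 0 <= \tr (A *m B).
Proof.
move=> /psdmxP[F ->] /psdmxP[G ->].
rewrite -mulmxA mxtrace_mulC mulmxA -mulmxA -{1}[F]trmxCK.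
have := gram_trace_ge0 (F *m G^t*).
by rewrite adjmxM !trmxCK !mulmxA.
Qed.

(** With [A] the Gram matrix of [F], the trace is the squared Hilbert-Schmidt norm of [W] times the
    adjoint of [F]. *)
Lemma psdmx_trace_eq0 m n (W : 'M[C]_(m, n)) (A : 'M[C]_n) :
  psdmx A -> \tr (W *m A *m W^t*) = 0 -> W *m A = 0.
Proof.
move=> /psdmxP[F ->] W0; rewrite mulmxA.
have -> : W *m F^t* = 0; last by rewrite mul0mx.
by apply: gram_trace_eq0; rewrite adjmxM trmxCK !mulmxA in W0 *.
Qed.

(** * Extensionality by the trace pairing and by product operators *)

Lemma mxtrace_mul_delta n (A : 'M[C]_n) i j :
  \tr (A *m delta_mx i j) = A j i.
Proof.
rewrite -(mul_delta_mx (0 : 'I_1)) mulmxA mxtrace_mulC mulmxA -rowE -colE.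
by rewrite /mxtrace big_ord1 !mxE.
Qed.

Lemma mxtrace_ext n (A B : 'M[C]_n) :
  (forall S, \tr (A *m S) = \tr (B *m S)) -> A = B.
Proof.
by move=> eqAB; apply/matrixP => i j; rewrite -!mxtrace_mul_delta eqAB.
Qed.

HB.instance Definition _ m1 n1 m2 n2
    (E : 'M[C]_m1 -> 'M[C]_n1) (F : 'M[C]_m2 -> 'M[C]_n2) :=
  GRing.isLinear.Build C 'M[C]_(m1 * m2) 'M[C]_(n1 * n2) *:%R (tens_map E F)
    (tens_map_linear E F).

Lemma delta_mx_tens m n i1 i2 j1 j2 :
  delta_mx (mxtens_index (i1, i2)) (mxtens_index (j1, j2))
    = delta_mx i1 j1 *t delta_mx i2 j2 :> 'M[C]_(m * n).
Proof.
apply/matrixP => k l.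
case: (mxtens_indexP k) => k1 k2; case: (mxtens_indexP l) => l1 l2.
rewrite tensmxE !mxE !(can_eq (@mxtens_indexK _ _)) !xpair_eqE -natrM mulnb.
by rewrite andbACA.
Qed.

(** Product operators span, since each matrix unit of the tensor product is one; linear identities
    may thus be checked on products. *)
Lemma tens_ind m n (P : 'M[C]_(m * n) -> Prop) :
  (forall A B, P (A *t B)) ->
  (forall a X Y, P X -> P Y -> P (a *: X + Y)) ->
  forall X, P X.
Proof.
move=> Ptens Plin X; rewrite [X]matrix_sum_delta.
have P0 : P 0 by rewrite -(tens0mx (0 : 'M_n)).
have PD A B : P A -> P B -> P (A + B).
  by move=> PA PB; rewrite -[A]scale1r; apply: Plin.
elim/big_ind: _ => // i _; elim/big_ind: _ => // j _.
rewrite -[_ *: _]addr0; apply: Plin => //.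
case: (mxtens_indexP i) => i1 i2; case: (mxtens_indexP j) => j1 j2.
by rewrite delta_mx_tens.
Qed.

(** * Channels in the Heisenberg picture *)

(* The adjoint of E for the bilinear trace pairing (Heisenberg picture). *)
Definition dual m n (E : 'M[C]_m -> 'M[C]_n) (X : 'M[C]_n) : 'M[C]_m :=
  \matrix_(i, j) \tr (X *m E (delta_mx j i)).

Lemma dualE m n (E : {linear 'M[C]_m -> 'M[C]_n}) X S :
  \tr (X *m E S) = \tr (dual E X *m S).
Proof.
rewrite [S]matrix_sum_delta !(linear_sum, mulmx_sumr) /=.
apply: eq_bigr => i _; rewrite !(linear_sum, mulmx_sumr) /=.
apply: eq_bigr => j _; rewrite linearZ /= -!scalemxAr !linearZ /=.
by rewrite mxtrace_mul_delta mxE.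
Qed.

Lemma dual1 m n (E : {linear 'M[C]_m -> 'M[C]_n}) :
  trace_preserving E -> dual E 1%:M = 1%:M.
Proof.
by move=> tpE; apply: mxtrace_ext => S; rewrite -dualE !mul1mx tpE.
Qed.

(** Complete positivity with a qubit ancilla, applied to the Gram matrix of the block row
    [[F, F B]]. Both the compatibility of [E] with adjoints and the Kadison-Schwarz inequality are
    read off from this block matrix. *)
Lemma cp_block m n (E : {linear 'M[C]_m -> 'M[C]_n}) p
    (F : 'M[C]_(p, m)) (B : 'M[C]_m) (S := F^t* *m F) :
  completely_positive E ->
  psdmx ((delta_mx 0 0 : 'M[C]_2) *t E S + delta_mx 0 1 *t E (S *m B)
    + delta_mx 1 0 *t E (B^t* *m S) + delta_mx 1 1 *t E (B^t* *m S *m B)).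
Proof.
move=> cpE; pose H := (delta_mx 0 0 : 'M[C]_(1, 2)) *t F
  + delta_mx 0 1 *t (F *m B).
have := cpE 2 _ (psdmx_gram H).
rewrite adjmxD !adjmx_tens !adjmx_delta adjmxM !mulmxDl !mulmxDr.
rewrite !tensmx_mul !mul_delta_mx !linearD /=.
rewrite !(tens_map_tens (idfun : {linear _ -> _}) E) /= !mulmxA.
by rewrite -!addrA -/S [X in _ + X]addrCA.
Qed.

(** For [F = 1] the off-diagonal blocks are the images of [B] and of its adjoint; a positive matrix
    is hermitian, so these blocks are adjoint to each other. *)
Lemma cp_adj m n (E : {linear 'M[C]_m -> 'M[C]_n}) (B : 'M[C]_m) :
  completely_positive E -> E (B^t*) = (E B)^t*.
Proof.
move=> cpE; have := cp_block 1%:M B cpE.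
rewrite adjmx1 !mulmx1 !mul1mx; set M := (X in psdmx X) => psdM.
apply/matrixP => i j; rewrite 2!mxE.
have -> : E (B^t*) i j = M (mxtens_index (1, i)) (mxtens_index (0, j)).
  by rewrite /M !mxE !mxtens_indexK /= !mul0r !mul1r !addr0 !add0r.
rewrite -(psdmx_herm psdM) 2!mxE.
by rewrite /M !mxE !mxtens_indexK /= !mul0r !mul1r !addr0 !add0r.
Qed.

Lemma dual_adj m n (E : {linear 'M[C]_m -> 'M[C]_n}) X :
  completely_positive E -> dual E (X^t*) = (dual E X)^t*.
Proof.
move=> cpE; apply: mxtrace_ext => S; rewrite -dualE.
rewrite -[S]trmxCK cp_adj // -!adjmxM !mxtrace_adj mxtrace_mulC dualE.
by rewrite mxtrace_mulC.
Qed.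

Lemma kadison_schwarz m n (E : {linear 'M[C]_m -> 'M[C]_n}) (X : 'M[C]_n) :
  is_channel E -> psdmx (dual E (X^t* *m X) - (dual E X)^t* *m dual E X).
Proof.
move=> [cpE tpE] v; set Xh := dual E X; set D := _ - _.
pose S := v^t*^t* *m v^t*.
have -> : (v^t* *m D *m v) 0 0 = \tr (D *m S).
  by rewrite /S trmxCK mulmxA mxtrace_mulC mulmxA /mxtrace big_ord1.
(* Pairing the Gram matrix of the block row [[X, -1]] with the block matrix for [B] the adjoint of
   [Xh] gives four terms; trace preservation makes two of them cancel, and the rest is the trace of
   [D *m S]. *)
pose K := (delta_mx 0 0 : 'M[C]_(1, 2)) *t X - delta_mx 0 1 *t 1%:M.
have := psdmx_trace_mul_ge0 (psdmx_gram K) (cp_block (v^t*) (Xh^t*) cpE).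
rewrite -/S -mulmxA mxtrace_mulC adjmxB !adjmx_tens !adjmx_delta adjmx1 trmxCK.
rewrite !(mulmxDl, mulmxDr, mulmxN, mulNmx, tensmx_mul, mul_delta_mx_cond) /=.
rewrite !(mul0mx, mulr0n, mulr1n, tens0mx, mul1mx, mulmx1, addr0, add0r).
rewrite !(oppr0, addr0, add0r, opprK) !(raddfD, raddfN) /= !mxtrace_tens.
rewrite (_ : \tr (delta_mx 0 0 : 'M[C]_1) = 1) ?mul1r; last first.
  by rewrite /mxtrace big_ord1 mxE.
rewrite [\tr (X *m E S *m _)]mxtrace_mulC mulmxA !(dualE E).
rewrite [\tr (E _ *m _)]mxtrace_mulC (dualE E) dual_adj // -/Xh tpE.
rewrite !mulmxA [\tr (Xh *m _ *m _ *m _)]mxtrace_mulC !mulmxA.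
by rewrite addNr addr0.
Qed.

Lemma tensmx_linl m n p q a (A B : 'M[C]_(m, n)) (D : 'M[C]_(p, q)) :
  (a *: A + B) *t D = a *: (A *t D) + B *t D.
Proof. by apply/matrixP => i j; rewrite !mxE mulrDl mulrA. Qed.

Lemma tensmx_linr m n p q a (A B : 'M[C]_(m, n)) (D : 'M[C]_(p, q)) :
  D *t (a *: A + B) = a *: (D *t A) + D *t B.
Proof. by apply/matrixP => i j; rewrite !mxE mulrDr mulrCA. Qed.

Lemma tensmx1 m n : (1%:M : 'M[C]_m) *t (1%:M : 'M[C]_n) = 1%:M.
Proof.
apply/matrixP => k l.
case: (mxtens_indexP k) => k1 k2; case: (mxtens_indexP l) => l1 l2.
by rewrite tensmxE !mxE (can_eq (@mxtens_indexK _ _)) xpair_eqE -natrM mulnb.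
Qed.

Lemma dual_tens m1 n1 m2 n2
    (E : {linear 'M[C]_m1 -> 'M[C]_n1}) (F : {linear 'M[C]_m2 -> 'M[C]_n2}) X Y :
  dual (tens_map E F) (X *t Y) = dual E X *t dual F Y.
Proof.
apply: mxtrace_ext => S; rewrite -dualE.
elim/tens_ind: S => [A B|a S1 S2 IH1 IH2].
  by rewrite /= tens_map_tens !tensmx_mul !mxtrace_tens !dualE.
rewrite linearP /= !mulmxDr -!scalemxAr !(linearD, linearZ) /=.
by rewrite IH1 IH2.
Qed.

(** * Correlations in the triangle network *)

(** Inverse of [source_index]. *)
Definition party_index lA lC mA mB nB nC
    (x : 'I_((lA * lC) * (mA * mB) * (nB * nC))) :
    'I_((lA * mA) * (mB * nB) * (lC * nC)) :=
  let: (lm, n) := mxtens_unindex x in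
  let: (l, m) := mxtens_unindex lm in
  let: (la, lc) := mxtens_unindex l in
  let: (ma, mb) := mxtens_unindex m in
  let: (nb, nc) := mxtens_unindex n in
  mxtens_index (mxtens_index (mxtens_index (la, ma), mxtens_index (mb, nb)),
                mxtens_index (lc, nc)).

Section Network.

Variables lA lC mA mB nB nC : nat.

Lemma source_index_bij : bijective (@source_index lA lC mA mB nB nC).
Proof.
exists (@party_index lA lC mA mB nB nC) => x.
  case: (mxtens_indexP x) => ab c; case: (mxtens_indexP ab) => a b.
  case: (mxtens_indexP a) => la ma; case: (mxtens_indexP b) => mb nb.
  case: (mxtens_indexP c) => lc nc.
  by rewrite /party_index /source_index !mxtens_indexK.
case: (mxtens_indexP x) => lm n; case: (mxtens_indexP lm) => l m.
case: (mxtens_indexP l) => la lc; case: (mxtens_indexP m) => ma mb.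
case: (mxtens_indexP n) => nb nc.
by rewrite /party_index /source_index !mxtens_indexK.
Qed.

Local Notation sort := (@sort_by_party C lA lC mA mB nB nC).

Lemma sort_by_partyM A B : sort (A *m B) = sort A *m sort B.
Proof.
apply/matrixP => i j; rewrite !mxE (reindex _ (onW_bij _ source_index_bij)).
by apply: eq_bigr => k _; rewrite !mxE.
Qed.

Lemma mxtrace_sort_by_party A : \tr (sort A) = \tr A.
Proof.
rewrite /mxtrace [RHS](reindex _ (onW_bij _ source_index_bij)).
by apply: eq_bigr => k _; rewrite !mxE.
Qed.

Lemma psdmx_sort_by_party A : psdmx A -> psdmx (sort A).
Proof.
move=> /psdmxP[F ->]; rewrite sort_by_partyM.
suff -> : sort (F^t*) = (sort F)^t* by apply: psdmx_gram.
by apply/matrixP => i j; rewrite !mxE.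
Qed.

Lemma sort_by_party_tens (P1 : 'M_lA) (S1 : 'M_lC) (P2 : 'M_mA) (Q1 : 'M_mB)
    (Q2 : 'M_nB) (S2 : 'M_nC) :
  sort ((P1 *t S1) *t (P2 *t Q1) *t (Q2 *t S2))
    = (P1 *t P2) *t (Q1 *t Q2) *t (S1 *t S2).
Proof.
apply/matrixP => x y.
case: (mxtens_indexP x) => ab c; case: (mxtens_indexP ab) => a b.
case: (mxtens_indexP a) => la ma; case: (mxtens_indexP b) => mb nb.
case: (mxtens_indexP c) => lc nc.
case: (mxtens_indexP y) => ab' c'; case: (mxtens_indexP ab') => a' b'.
case: (mxtens_indexP a') => la' ma'; case: (mxtens_indexP b') => mb' nb'.
case: (mxtens_indexP c') => lc' nc'.
rewrite !tensmxE [LHS]mxE /source_index !mxtens_indexK !tensmxE.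
ring.
Qed.

Variables (L : 'M[C]_(lA * lC)) (M : 'M[C]_(mA * mB)) (N : 'M[C]_(nB * nC)).
Hypotheses (trL : \tr L = 1) (trM : \tr M = 1) (trN : \tr N = 1).

(** Expectation, in the joint state of the sources, of a product of observables on the inputs of A,
    B and C. *)
Local Notation "\tau( P , Q , S )" :=
  (\tr (P *t Q *t S *m sort_by_party (L *t M *t N)))
  (format "\tau( P ,  Q ,  S )").

Lemma tau_tens P1 P2 Q1 Q2 S1 S2 :
  \tau(P1 *t P2, Q1 *t Q2, S1 *t S2)
    = \tr (P1 *t S1 *m L) * \tr (P2 *t Q1 *m M) * \tr (Q2 *t S2 *m N).
Proof.
rewrite -sort_by_party_tens -sort_by_partyM mxtrace_sort_by_party.
by rewrite !tensmx_mul !mxtrace_tens.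
Qed.

(** When nothing is measured at C, only B sees the source [N], so its contribution splits off. *)
Lemma tau_A_M P Q1 Q2 :
  \tau(P, Q1 *t Q2, 1%:M)
    = \tau(P, Q1 *t 1%:M, 1%:M) * \tr (Q2 *t 1%:M *m N).
Proof.
elim/tens_ind: P => [P1 P2|a P P' IH IH'].
  by rewrite -tensmx1 !tau_tens tensmx1 mul1mx trN mulr1.
rewrite !tensmx_linl !mulmxDl -!scalemxAl !(linearD, linearZ) /=.
by rewrite IH IH' mulrDl mulrA.
Qed.

(** When nothing is measured at A, B's share of [M] is independent of C, which receives only from
    [L] and [N]. *)
Lemma tau_M_C Q1 S :
  \tau(1%:M, Q1 *t 1%:M, S) = \tr (1%:M *t Q1 *m M) * \tau(1%:M, 1%:M, S).
Proof.
elim/tens_ind: S => [S1 S2|a S S' IH IH'].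
  by rewrite -!tensmx1 !tau_tens tensmx1 mul1mx trM mulr1 mulrAC mulrC mulrA.
rewrite !tensmx_linr !mulmxDl -!scalemxAl !(linearD, linearZ) /=.
by rewrite IH IH' mulrDr mulrCA.
Qed.

(* A meets B only through M, which does not feed C: an observable of A that can
   be moved to C is uncorrelated with B. *)
Lemma tau_decorrelated X Z :
  (forall Q, \tau(X, Q, 1%:M) = \tau(1%:M, Q, Z)) ->
  forall Q, \tau(X, Q, 1%:M) = \tau(1%:M, Q, 1%:M) * \tau(X, 1%:M, 1%:M).
Proof.
move=> XZ; elim/tens_ind => [Q1 Q2|a Q Q' IH IH'].
  (* Split off [Q2] with [N], move [X] over to C as [Z], where it is independent of [Q1], then move
     it back to A. *)
  rewrite tau_A_M XZ tau_M_C -XZ [in RHS]tau_A_M tau_M_C.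
  have -> : \tau(1%:M, 1%:M, 1%:M) = 1.
    rewrite !tensmx1 mul1mx mxtrace_sort_by_party !mxtrace_tens.
    by rewrite trL trM trN !mulr1.
  by rewrite mulr1 mulrAC.
rewrite !(tensmx_linr, tensmx_linl) !mulmxDl -!scalemxAl !(linearD, linearZ) /=.
by rewrite IH IH' mulrDl mulrA.
Qed.

End Network.

(** * Rigidity of pure outputs *)

Lemma mxtrace_ketbra n (A : 'M[C]_n) (v : 'cV[C]_n) :
  \tr (A *m ketbra v) = (v^t* *m A *m v) 0 0.
Proof.
by rewrite /ketbra mulmxA mxtrace_mulC mulmxA /mxtrace big_ord1.
Qed.

Lemma mxtrace_ketbra_gram m n (F G : 'M[C]_(m, n)) (v : 'cV[C]_n) :
  \tr (F^t* *m G *m ketbra v) = ((F *m v)^t* *m (G *m v)) 0 0.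
Proof. by rewrite mxtrace_ketbra adjmxM !mulmxA. Qed.

(** Equality case of Cauchy-Schwarz: the squared norm of [v - t u] is that of [v] minus the squared
    modulus of [t]. *)
Lemma cauchy_schwarz_eq n (u v : 'cV[C]_n) (t := (u^t* *m v) 0 0) :
  unit_vector u -> (v^t* *m v) 0 0 = t^* * t -> v = t *: u.
Proof.
move=> u1 vv; apply/eqP; rewrite -subr_eq0; apply/eqP.
apply: gram_trace_eq0; rewrite mxtrace_mulC /mxtrace big_ord1.
have tE : u^t* *m v = t%:M by apply: mx11_scalar.
have tE' : v^t* *m u = (t^*)%:M.
  by rewrite -[LHS]trmxCK adjmxM trmxCK tE tr_scalar_mx map_scalar_mx.
rewrite adjmxB adjmxZ !(mulmxBl, mulmxBr) -!scalemxAl -!scalemxAr.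
have vE : v^t* *m v = (t^* * t)%:M by rewrite [LHS]mx11_scalar vv.
rewrite u1 tE tE' vE !mxE /= !mulr1n.
ring.
Qed.

Lemma triangle_correlated_eigen a b c (psi : 'cV[C]_(a * b * c)) X Y Z
    (T := (X *t 1%:M *t 1%:M) *m psi) :
  unit_vector psi -> triangle_compatible (ketbra psi) ->
  (1%:M *t Y *t 1%:M) *m psi = T -> (1%:M *t 1%:M *t Z) *m psi = T ->
  exists t : C, T = t *: psi.
Proof.
move=> psi1 [lA [lC [mA [mB [nB [nC [L [M [N [EA [EB [EC]]]]]]]]]]]].
move=> [[[psdL trL] [psdM trM] [psdN trN]] [[chA chB chC] rhoE]] TY TZ.
pose sigma := sort_by_party (L *t M *t N).
have [cpA tpA] := chA; have [cpB tpB] := chB; have [cpC tpC] := chC.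
have psd_sigma : psdmx sigma.
  by apply/psdmx_sort_by_party/psdmx_tens => //; apply: psdmx_tens.
(* Expectations of dual observables in the sources are expectations in [psi]; unital duals let any
   [1%:M] be read as a dual. *)
have tauE P Q S : \tr (dual EA P *t dual EB Q *t dual EC S *m sigma)
    = \tr (P *t Q *t S *m ketbra psi).
  by rewrite rhoE [RHS](dualE (tens_map (tens_map EA EB) EC)) !dual_tens.
have psd1 n : psdmx (1%:M : 'M[C]_n).
  by have := psdmx_gram (1%:M : 'M[C]_n); rewrite adjmx1 mul1mx.
set Xh := dual EA X; set Zh := dual EC Z.
pose n := (T^t* *m T) 0 0.
(* The square of a dual observable is not itself known to be a dual, so Kadison-Schwarz yields only
   a bound. The mixed terms below involve two distinct parties and are computed exactly. *)
have tauX : \tr (Xh^t* *m Xh *t 1%:M *t 1%:M *m sigma) <= n.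
  have := psdmx_trace_mul_ge0
    (psdmx_tens (psdmx_tens (kadison_schwarz X chA) (psd1 _)) (psd1 _)) psd_sigma.
  rewrite -/Xh -scaleN1r addrC !tensmx_linl mulmxDl -scalemxAl linearD linearZ /=.
  rewrite mulN1r addrC subr_ge0 => /le_trans-> //.
  rewrite -(dual1 tpB) -(dual1 tpC) tauE.
  have -> : X^t* *m X *t 1%:M *t 1%:M
      = (X *t 1%:M *t 1%:M : 'M_(a * b * c))^t* *m (X *t 1%:M *t 1%:M).
    by rewrite !adjmx_tens !adjmx1 !tensmx_mul !mul1mx.
  by rewrite mxtrace_ketbra_gram.
have tauZ : \tr (1%:M *t 1%:M *t (Zh^t* *m Zh) *m sigma) <= n.
  have := psdmx_trace_mul_ge0
    (psdmx_tens (psdmx_tens (psd1 _) (psd1 _)) (kadison_schwarz Z chC)) psd_sigma.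
  rewrite -/Zh -scaleN1r addrC !tensmx_linr mulmxDl -scalemxAl linearD linearZ /=.
  rewrite mulN1r addrC subr_ge0 => /le_trans-> //.
  rewrite -(dual1 tpA) -(dual1 tpB) tauE.
  have -> : 1%:M *t 1%:M *t (Z^t* *m Z)
      = (1%:M *t 1%:M *t Z : 'M_(a * b * c))^t* *m (1%:M *t 1%:M *t Z).
    by rewrite !adjmx_tens !adjmx1 !tensmx_mul !mul1mx.
  by rewrite mxtrace_ketbra_gram TZ.
have tauXZ : \tr (Xh^t* *t 1%:M *t Zh *m sigma) = n.
  rewrite -dual_adj // -(dual1 tpB) tauE.
  have -> : X^t* *t 1%:M *t Z
      = (X *t 1%:M *t 1%:M : 'M_(a * b * c))^t* *m (1%:M *t 1%:M *t Z).
    by rewrite !adjmx_tens !adjmx1 !tensmx_mul !mul1mx mulmx1.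
  by rewrite mxtrace_ketbra_gram TZ.
have tauZX : \tr (Xh *t 1%:M *t Zh^t* *m sigma) = n.
  rewrite -dual_adj // -(dual1 tpB) tauE.
  have -> : X *t 1%:M *t Z^t*
      = (1%:M *t 1%:M *t Z : 'M_(a * b * c))^t* *m (X *t 1%:M *t 1%:M).
    by rewrite !adjmx_tens !adjmx1 !tensmx_mul !mul1mx mulmx1.
  by rewrite mxtrace_ketbra_gram TZ.
pose W := Xh *t (1%:M : 'M[C]_(mB * nB)) *t (1%:M : 'M[C]_(lC * nC))
  - 1%:M *t 1%:M *t Zh.
(* The expectation of the adjoint of [W] times [W] is nonnegative and at most [n + n - n - n]. *)
have W0 : W *m sigma = 0.
  apply: psdmx_trace_eq0 => //; apply/eqP; rewrite mxtrace_mulC mulmxA eq_le.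
  rewrite psdmx_trace_mul_ge0 ?andbT //; last exact: psdmx_gram.
  rewrite adjmxB !adjmx_tens !adjmx1.
  rewrite !(mulmxBl, mulmxBr) !tensmx_mul !mul1mx !mulmx1.
  rewrite !linearB /= tauXZ tauZX.
  have := lerD tauX tauZ; rewrite -subr_le0; congr (_ <= 0); ring.
have XZ Q : \tr (Xh *t Q *t 1%:M *m sigma) = \tr (1%:M *t Q *t Zh *m sigma).
  apply/eqP; rewrite -subr_eq0 -linearB /= -mulmxBl.
  have -> : Xh *t Q *t 1%:M - 1%:M *t Q *t Zh = (1%:M *t Q *t 1%:M) *m W.
    by rewrite mulmxBr !tensmx_mul !mul1mx !mulmx1.
  by rewrite -mulmxA W0 mulmx0 linear0.
(* With [Y] acting on [psi] as [X] does, decorrelation from the adjoint of [Y] says that the squared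
   norm of [T] is the squared modulus of its overlap with [psi]. *)
have := tau_decorrelated trL trM trN XZ (dual EB (Y^t*)).
rewrite -/sigma -(dual1 tpA) -(dual1 tpB) -(dual1 tpC) !tauE => H.
exists ((psi^t* *m T) 0 0); apply: cauchy_schwarz_eq => //.
move: H.
have -> : X *t Y^t* *t 1%:M
    = (1%:M *t Y *t 1%:M : 'M_(a * b * c))^t* *m (X *t 1%:M *t 1%:M).
  by rewrite !adjmx_tens !adjmx1 !tensmx_mul !mul1mx mulmx1.
rewrite mxtrace_ketbra_gram TY -/T => ->; congr (_ * _); last first.
  by rewrite mxtrace_ketbra -mulmxA.
have -> : 1%:M *t Y^t* *t 1%:M
    = (1%:M *t Y *t 1%:M : 'M_(a * b * c))^t* *m 1%:M.
  by rewrite !adjmx_tens !adjmx1 mulmx1.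
rewrite mxtrace_ketbra_gram TY mul1mx.
have -> : psi^t* *m T = (T^t* *m psi)^t* by rewrite adjmxM trmxCK.
by rewrite [in RHS]mxE [in RHS]mxE conjCK.
Qed.

Lemma sum_tens m n (F : 'I_(m * n) -> C) :
  \sum_x F x = \sum_x \sum_y F (mxtens_index (x, y)).
Proof.
rewrite pair_big (reindex (@mxtens_index m n)) /=; last first.
  by exists (@mxtens_unindex m n) => x _; rewrite ?mxtens_indexK ?mxtens_unindexK.
by apply: eq_bigr => -[].
Qed.

Lemma mx_tens_entries a b c a' b' c' (psi : 'cV[C]_(a * b * c))
    (X : 'M_(a', a)) (Y : 'M_(b', b)) (Z : 'M_(c', c)) i j k :
  (X *t Y *t Z *m psi) (mxtens_index (mxtens_index (i, j), k)) 0
  = \sum_i' \sum_j' \sum_k' X i i' * Y j j' * Z k k'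
      * psi (mxtens_index (mxtens_index (i', j'), k')) 0.
Proof.
rewrite mxE !sum_tens; do 3 apply: eq_bigr => ? _.
by rewrite !tensmxE.
Qed.

(** * Three qubits *)

Lemma ord2P (P : 'I_2 -> Prop) : P 0 -> P 1 -> forall i, P i.
Proof.
move=> P0 P1 [[|[|//]] lti].
  by rewrite (_ : Ordinal _ = 0) //; apply: val_inj.
by rewrite (_ : Ordinal _ = 1) //; apply: val_inj.
Qed.

(** A column with a nonzero entry in row 0 fixes the ratio of the rows; if there is none, row 0
    vanishes and row 1 serves as [w]. *)
Lemma minors_rank1 (T : finType) (f : 'I_2 -> T -> C) :
  (forall x y, f 0 x * f 1 y = f 0 y * f 1 x) ->
  exists u w, forall i x, f i x = u i * w x.
Proof.
move=> minors; case: (pickP (fun x => f 0 x != 0)) => [x fx | f0].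
  exists (fun i => if i == 0 then 1 else f 1 x / f 0 x), (f 0).
  apply: ord2P => y /=; first by rewrite mul1r.
  by rewrite mulrAC [f 1 x * _]mulrC -minors mulrAC mulfV ?mul1r.
exists (fun i => if i == 0 then 0 else 1), (f 1).
apply: ord2P => y /=; last by rewrite mul1r.
by have /negbFE/eqP-> := f0 y; rewrite mul0r.
Qed.

(** Both [a] and [b] times any minor are combinations of the given relations, so all minors
    vanish. *)
Lemma dependent_rank1 (T : finType) (f : 'I_2 -> T -> C) a b :
  (a != 0) || (b != 0) -> (forall x, a * f 0 x + b * f 1 x = 0) ->
  exists u w, forall i x, f i x = u i * w x.
Proof.
move=> ab0 dep; apply: minors_rank1 => x y; apply/eqP; rewrite -subr_eq0.
have /eqP : a * (f 0 x * f 1 y - f 0 y * f 1 x) = 0.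
  have -> : a * (f 0 x * f 1 y - f 0 y * f 1 x)
    = (a * f 0 x + b * f 1 x) * f 1 y - (a * f 0 y + b * f 1 y) * f 1 x by ring.
  by rewrite !dep !mul0r subrr.
have /eqP : b * (f 0 x * f 1 y - f 0 y * f 1 x) = 0.
  have -> : b * (f 0 x * f 1 y - f 0 y * f 1 x)
    = (a * f 0 y + b * f 1 y) * f 0 x - (a * f 0 x + b * f 1 x) * f 0 y by ring.
  by rewrite !dep !mul0r subrr.
by rewrite !mulf_eq0; case: (a == 0) ab0 => //=; case: (b == 0).
Qed.

(* With Q the Gram matrix of the quadratic form det (x_0 f_0 + x_1 f_1) in the
   slices f_0, f_1 of f, this is 2 Q [[0, 1], [-1, 0]]. *)
Definition slice_mx (f : 'I_2 -> 'I_2 -> 'I_2 -> C) : 'M[C]_2 :=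
  let d i := f i 0 0 * f i 1 1 - f i 0 1 * f i 1 0 in
  let e := f 0 0 0 * f 1 1 1 + f 1 0 0 * f 0 1 1
           - f 0 0 1 * f 1 1 0 - f 1 0 1 * f 0 1 0 in
  \matrix_(i, j) if i == 0 then (if j == 0 then - e else 2 * d 0)
                 else (if j == 0 then - (2 * d 1) else e).

Lemma slice_mx_swap (f : 'I_2 -> 'I_2 -> 'I_2 -> C) :
  slice_mx (fun i k j => f i j k) = slice_mx f.
Proof.
apply/matrixP => i j; rewrite !mxE; move: i j.
by do 2!apply: ord2P; rewrite /=; ring.
Qed.

(** The operators built from the slices along the first and the second index act alike on [f]: a
    cubic polynomial identity, checked on its eight entries. It provides the operators correlated
    across the parties. *)
Lemma slice_mx_eq (f : 'I_2 -> 'I_2 -> 'I_2 -> C) i j k :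
  \sum_i' slice_mx f i i' * f i' j k
  = \sum_j' slice_mx (fun j i k => f i j k) j j' * f i j' k.
Proof.
rewrite !big_ord_recl !big_ord0 !addr0 !mxE.
rewrite (_ : lift ord0 ord0 = 1 :> 'I_2); last exact: val_inj.
rewrite (_ : ord0 = 0 :> 'I_2); last exact: val_inj.
move: i; apply: ord2P; move: j; apply: ord2P; move: k; apply: ord2P => /=; ring.
Qed.

Section ThreeQubits.

Variable psi : 'cV[C]_(2 * 2 * 2).
Let p (i j k : 'I_2) : C := psi (mxtens_index (mxtens_index (i, j), k)) 0.

(** The hypotheses say that the determinant of the pencil of slices along A vanishes identically.
    The two slices then have rank at most one, and the mixed coefficient is a product of two
    determinants: one vanishes if the B factors are parallel, the other if the C factors are. *)
Lemma singular_slices_product :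
  (forall i, p i 0 0 * p i 1 1 = p i 0 1 * p i 1 0) ->
  p 0 0 0 * p 1 1 1 + p 1 0 0 * p 0 1 1
    = p 0 0 1 * p 1 1 0 + p 1 0 1 * p 0 1 0 ->
  product_B_AC (a := 2) (b := 2) (c := 2) psi
  \/ product_C_AB (a := 2) (b := 2) (c := 2) psi.
Proof.
move=> sing mixed.
have rank1 i : exists u w, forall j k, p i j k = u j * w k.
  apply: minors_rank1 => k l; move: k l; apply: ord2P; apply: ord2P => //.
have [a [b p0]] := rank1 0; have [c [d p1]] := rank1 1.
have : (a 0 * c 1 - a 1 * c 0) * (b 0 * d 1 - b 1 * d 0) = 0.
  move/eqP: mixed; rewrite -subr_eq0 !p0 !p1 => /eqP <-; ring.
move=> /eqP; rewrite mulf_eq0 !subr_eq0 => /orP[] /eqP minor; [left|right].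
  have [i j|u [s us]] := @minors_rank1 'I_2
    (fun j i => if i == 0 then a j else c j).
    by move: i j; apply: ord2P; apply: ord2P => //=; rewrite minor mulrC.
  exists (\col_j u j),
    (\col_x let: (i, k) := mxtens_unindex x in
            s i * (if i == 0 then b k else d k)).
  move=> i j k; rewrite !mxE mxtens_indexK -/(p i j k) mulrA -us.
  by move: i; apply: ord2P => /=; rewrite ?p0 ?p1.
have [i j|u [s us]] := @minors_rank1 'I_2
  (fun k i => if i == 0 then b k else d k).
  by move: i j; apply: ord2P; apply: ord2P => //=; rewrite minor mulrC.
exists (\col_j u j),
  (\col_x let: (i, j) := mxtens_unindex x in
          s i * (if i == 0 then a j else c j)).
move=> i j k; rewrite !mxE mxtens_indexK -/(p i j k) mulrA -us.
by move: i; apply: ord2P => /=; rewrite ?p0 ?p1 mulrC.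
Qed.

Lemma slice_eigen_product t :
  (forall i j k, \sum_i' slice_mx p i i' * p i' j k = t * p i j k) ->
  [\/ product_A_BC (a := 2) (b := 2) (c := 2) psi,
      product_B_AC (a := 2) (b := 2) (c := 2) psi
    | product_C_AB (a := 2) (b := 2) (c := 2) psi].
Proof.
move=> eig.
(* Row [i] of [slice_mx p - t] lists the coefficients of a linear relation between the two slices
   along A. *)
have dep i : (slice_mx p i 0 - t *+ (i == 0) != 0)
    || (slice_mx p i 1 - t *+ (i == 1) != 0) ->
    product_A_BC (a := 2) (b := 2) (c := 2) psi.
  move=> nz.
  pose f i (jk : 'I_2 * 'I_2) := p i jk.1 jk.2.
  have [jk|u [w uw]] := @dependent_rank1 _ f _ _ nz.
    have := eig i jk.1 jk.2; move=> /eqP; rewrite -subr_eq0 => /eqP <-.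
    rewrite !big_ord_recl !big_ord0 !addr0.
    rewrite (_ : lift ord0 ord0 = 1 :> 'I_2); last exact: val_inj.
    rewrite (_ : ord0 = 0 :> 'I_2); last exact: val_inj.
    by move: {nz} i; apply: ord2P; rewrite /f /=; ring.
  exists (\col_i u i), (\col_x w (mxtens_unindex x)) => i' j k.
  by rewrite !mxE mxtens_indexK -uw.
have [/dep|] := boolP ((slice_mx p 0 0 - t *+ (0 == 0 :> 'I_2) != 0)
    || (slice_mx p 0 1 - t *+ (0 == 1 :> 'I_2) != 0)); first by constructor.
rewrite negb_or !negbK /= mulr0n subr0 mulr1n => /andP[/eqP s00 /eqP s01].
have [/dep|] := boolP ((slice_mx p 1 0 - t *+ (1 == 0 :> 'I_2) != 0)
    || (slice_mx p 1 1 - t *+ (1 == 1 :> 'I_2) != 0)); first by constructor.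
rewrite negb_or !negbK /= mulr0n subr0 mulr1n => /andP[/eqP s10 /eqP s11].
move: s00 s01 s10 s11; rewrite !mxE /=; set e := _ - _ - _.
move=> s00 s01 s10 s11.
have two : 2 != 0 :> C by rewrite pnatr_eq0.
(* The diagonal entries [- e] and [e] both equal [t]. *)
have e0 : e = 0.
  apply: (mulfI two); rewrite (_ : 2 * e = (e - t) - (- e - t)); last by ring.
  by rewrite s00 s11 subrr mulr0.
have [||pB|pC] := singular_slices_product.
- apply: ord2P; apply/eqP; rewrite -subr_eq0.
    by move/eqP: s01; rewrite mulf_eq0 (negbTE two).
  by move/eqP: s10; rewrite oppr_eq0 mulf_eq0 (negbTE two).
- apply/eqP; rewrite -subr_eq0 -e0 /e; apply/eqP; ring.
- by constructor.
- by constructor.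
Qed.

Lemma triangle_product : unit_vector psi ->
  triangle_compatible (a := 2) (b := 2) (c := 2) (ketbra psi) ->
  [\/ product_A_BC (a := 2) (b := 2) (c := 2) psi,
      product_B_AC (a := 2) (b := 2) (c := 2) psi
    | product_C_AB (a := 2) (b := 2) (c := 2) psi].
Proof.
move=> psi1 tri.
pose Y := slice_mx (fun j i k => p i j k).
pose Z := slice_mx (fun k i j => p i j k).
have entry (x : 'I_(2 * 2 * 2)) :
    exists i j k, x = mxtens_index (mxtens_index (i, j), k).
  case: (mxtens_indexP x) => ij k; case: (mxtens_indexP ij) => i j.
  by exists i, j, k.
have one_sum n (F : 'I_n -> C) i : \sum_j (1%:M : 'M[C]_n) i j * F j = F i.
  rewrite (bigD1 i) //= big1 => [|j ji]; first by rewrite addr0 mxE eqxx mul1r.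
  by rewrite mxE eq_sym (negbTE ji) mul0r.
have actA (X : 'M_2) i j k :
    (X *t 1%:M *t 1%:M *m psi) (mxtens_index (mxtens_index (i, j), k)) 0
    = \sum_i' X i i' * p i' j k.
  rewrite mx_tens_entries; apply: eq_bigr => i' _.
  under eq_bigr do under eq_bigr do rewrite -!mulrA.
  under eq_bigr do rewrite -!mulr_sumr one_sum.
  by rewrite -mulr_sumr one_sum.
have actB (X : 'M_2) i j k :
    (1%:M *t X *t 1%:M *m psi) (mxtens_index (mxtens_index (i, j), k)) 0
    = \sum_j' X j j' * p i j' k.
  rewrite mx_tens_entries.
  under eq_bigr do under eq_bigr do under eq_bigr do rewrite -!mulrA.
  under eq_bigr do under eq_bigr do rewrite -!mulr_sumr one_sum.
  by under eq_bigr do rewrite -mulr_sumr; rewrite one_sum.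
have actC (X : 'M_2) i j k :
    (1%:M *t 1%:M *t X *m psi) (mxtens_index (mxtens_index (i, j), k)) 0
    = \sum_k' X k k' * p i j k'.
  rewrite mx_tens_entries.
  under eq_bigr do under eq_bigr do under eq_bigr do rewrite -!mulrA.
  under eq_bigr do under eq_bigr do rewrite -!mulr_sumr.
  by under eq_bigr do rewrite -mulr_sumr one_sum; rewrite one_sum.
have [||t eig] := @triangle_correlated_eigen 2 2 2 psi (slice_mx p) Y Z psi1 tri.
- apply/matrixP => x y; rewrite [y]ord1; have [i [j [k ->]]] := entry x.
  by rewrite actA actB slice_mx_eq.
- apply/matrixP => x y; rewrite [y]ord1; have [i [j [k ->]]] := entry x.
  (* The identity for C is the one for B with the last two indices exchanged. *)
  by rewrite actA actC -slice_mx_swap (slice_mx_eq (fun i k j => p i j k)).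
apply: (@slice_eigen_product t) => i j k; rewrite -actA.
by rewrite eig [LHS]mxE.
Qed.

End ThreeQubits.

(** * Preparing product vectors *)

Definition conj_by m n (V : 'M[C]_(n, m)) (X : 'M[C]_m) := V *m X *m V^t*.

Lemma conj_by_linear m n (V : 'M[C]_(n, m)) : linear (conj_by V).
Proof.
by move=> a X Y; rewrite /conj_by mulmxDr mulmxDl -scalemxAr -scalemxAl.
Qed.

HB.instance Definition _ m n (V : 'M[C]_(n, m)) :=
  GRing.isLinear.Build C 'M[C]_m 'M[C]_n *:%R (conj_by V) (conj_by_linear V).

(** Pointwise equality in the hypotheses admits the identity on an ancilla and nested tensor
    products of maps. *)
Lemma tens_map_conj_by m1 n1 m2 n2 (V : 'M[C]_(n1, m1)) (W : 'M[C]_(n2, m2)) E F :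
  E =1 conj_by V -> F =1 conj_by W -> tens_map E F =1 conj_by (V *t W).
Proof.
move=> EV FW X; transitivity (tens_map (conj_by V) (conj_by W) X).
  by do 4 apply: eq_bigr => ? _; rewrite EV FW.
elim/tens_ind: X => [A B|a X Y IHX IHY]; last by rewrite !linearP /= IHX IHY.
by rewrite tens_map_tens /conj_by adjmx_tens !tensmx_mul.
Qed.

Lemma conj_by_channel m n (V : 'M[C]_(n, m)) :
  V^t* *m V = 1%:M -> is_channel (conj_by V).
Proof.
move=> VV; split=> [k X psdX | X]; last first.
  by rewrite /= /conj_by mxtrace_mulC mulmxA VV mul1mx.
rewrite (@tens_map_conj_by _ _ _ _ 1%:M V) // => [|Y]; first exact: psdmx_conj.
by rewrite /conj_by adjmx1 mul1mx mulmx1.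
Qed.

Lemma unit_vector_state n (v : 'cV[C]_n) : unit_vector v -> is_state (ketbra v).
Proof.
move=> v1; split; last by rewrite /ketbra mxtrace_mulC v1 mxtrace1.
by rewrite /ketbra -[X in X *m _]trmxCK; apply: psdmx_gram.
Qed.

(** Pure sources processed by local isometries give a pure output, so comparing amplitudes
    suffices. *)
Lemma pure_triangle_compatible a b c lA lC mA mB nB nC
    (L : 'cV[C]_(lA * lC)) (M : 'cV[C]_(mA * mB)) (N : 'cV[C]_(nB * nC))
    (VA : 'M[C]_(a, lA * mA)) (VB : 'M[C]_(b, mB * nB)) (VC : 'M[C]_(c, lC * nC))
    (psi : 'cV[C]_(a * b * c)) :
  unit_vector L -> unit_vector M -> unit_vector N ->
  VA^t* *m VA = 1%:M -> VB^t* *m VB = 1%:M -> VC^t* *m VC = 1%:M ->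
  (forall i j k, psi (mxtens_index (mxtens_index (i, j), k)) 0
    = \sum_x \sum_y \sum_z VA i x * VB j y * VC k z *
        (L *t M *t N)
          (source_index (mxtens_index (mxtens_index (x, y), z))) 0) ->
  triangle_compatible (ketbra psi).
Proof.
move=> L1 M1 N1 VA1 VB1 VC1 psiE.
exists lA, lC, mA, mB, nB, nC, (ketbra L), (ketbra M), (ketbra N).
exists (conj_by VA), (conj_by VB), (conj_by VC).
split; first by split; exact: unit_vector_state.
split; first by split; exact: conj_by_channel.
pose phi : 'cV_(_ * _) := rowsub (@source_index lA lC mA mB nB nC) (L *t M *t N).
have -> : psi = (VA *t VB *t VC) *m phi.
  apply/matrixP => x y; rewrite [y]ord1.
  case: (mxtens_indexP x) => ij k; case: (mxtens_indexP ij) => i j.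
  rewrite mx_tens_entries psiE; do 3 apply: eq_bigr => ? _.
  by rewrite [phi _ _]mxE.
have -> : sort_by_party (ketbra L *t ketbra M *t ketbra N) = ketbra phi.
  rewrite /ketbra -!tensmx_mul -!adjmx_tens.
  by apply/matrixP => x y; rewrite !mxE; apply: eq_bigr => z _; rewrite !mxE.
rewrite (tens_map_conj_by (tens_map_conj_by (frefl _) (frefl _)) (frefl _)).
by rewrite /conj_by /ketbra adjmxM !mulmxA.
Qed.

(** [rowsub g 1%:M] relabels the basis along [g]. It models a party that keeps its share of one
    source, the other share being one-dimensional. *)
Lemma sum_rowsub1 m n (g : 'I_m -> 'I_n) (F : 'I_n -> C) i :
  \sum_y rowsub g 1%:M i y * F y = F (g i).
Proof.
rewrite (bigD1 (g i)) //= big1 => [|y yi].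
  by rewrite addr0 !mxE eqxx mul1r.
by rewrite !mxE eq_sym (negbTE yi) mul0r.
Qed.

Lemma rowsub1_isometry m n (g : 'I_m -> 'I_n) :
  bijective g -> (rowsub g 1%:M : 'M[C]_(m, n))^t* *m rowsub g 1%:M = 1%:M.
Proof.
case=> h gK hK; apply/matrixP => y z; rewrite mxE.
rewrite (bigD1 (h y)) //= big1 => [|i iy].
  by rewrite addr0 !mxE !hK eqxx rmorph1 mul1r.
rewrite !mxE (_ : g i == y = false) ?rmorph0 ?mul0r //.
by apply/negbTE; apply: contra iy => /eqP <-; rewrite gK.
Qed.

Lemma unit_vectorP n (v : 'cV[C]_n) :
  unit_vector v <-> \sum_i (v i 0)^* * v i 0 = 1.
Proof.
have vE : (v^t* *m v) 0 0 = \sum_i (v i 0)^* * v i 0.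
  by rewrite mxE; apply: eq_bigr => i _; rewrite !mxE.
split=> [v1 | v1]; first by rewrite -vE v1 mxE.
by rewrite /unit_vector [LHS]mx11_scalar vE v1.
Qed.

(** Dividing [u] by its norm [r] and multiplying [w] by [r] keeps all products, and the second norm
    becomes 1 as well. *)
Lemma normalize_factors m n (u : 'cV[C]_m) (w : 'cV[C]_n) :
  (\sum_i (u i 0)^* * u i 0) * (\sum_j (w j 0)^* * w j 0) = 1 ->
  exists u' w', [/\ unit_vector u', unit_vector w'
    & forall i j, u' i 0 * w' j 0 = u i 0 * w j 0].
Proof.
set nu := \sum_i _; set nw := \sum_i _ => uw.
have nu_ge0 : 0 <= nu by apply: sumr_ge0 => i _; rewrite mulrC mul_conjC_ge0.
have nu0 : nu != 0 by apply: contra_eq_neq uw => ->; rewrite mul0r eq_sym oner_eq0.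
pose r := sqrtC nu.
have r_ge0 : 0 <= r by rewrite sqrtC_ge0.
have r0 : r != 0 by rewrite sqrtC_eq0.
have rr : r * r = nu by rewrite -expr2 sqrtCK.
have norm_scale k c (v : 'cV[C]_k) : 0 <= c ->
    \sum_i ((c *: v) i 0)^* * (c *: v) i 0
    = c * c * \sum_i (v i 0)^* * v i 0.
  move=> c0; rewrite mulr_sumr; apply: eq_bigr => i _.
  by rewrite !mxE rmorphM /= (geC0_conj c0) mulrACA.
exists (r^-1 *: u), (r *: w); split.
- by apply/unit_vectorP; rewrite norm_scale ?invr_ge0 // -invfM rr mulVf.
- by apply/unit_vectorP; rewrite norm_scale // rr.
- by move=> i j; rewrite !mxE mulrACA mulVf // mul1r.
Qed.

Lemma unit_vector_tens a b c (psi : 'cV[C]_(a * b * c)) : unit_vector psi ->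
  \sum_i \sum_j \sum_k (psi (mxtens_index (mxtens_index (i, j), k)) 0)^*
    * psi (mxtens_index (mxtens_index (i, j), k)) 0 = 1.
Proof. by move=> /unit_vectorP; rewrite !sum_tens. Qed.

Lemma unit_vector_const1 : unit_vector (const_mx 1 : 'cV[C]_(1 * 1)).
Proof. by apply/unit_vectorP; rewrite big_ord1 !mxE rmorph1 mul1r. Qed.

Lemma mxtens_index_0l_bij n :
  bijective (fun j : 'I_n => mxtens_index (0 : 'I_1, j)).
Proof.
exists (fun x => (mxtens_unindex x).2) => [j | x]; first by rewrite mxtens_indexK.
by case: (mxtens_indexP x) => i j; rewrite (ord1 i) mxtens_indexK.
Qed.

Lemma mxtens_index_0r_bij n :
  bijective (fun j : 'I_n => mxtens_index (j, 0 : 'I_1)).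
Proof.
exists (fun x => (mxtens_unindex x).1) => [j | x]; first by rewrite mxtens_indexK.
by case: (mxtens_indexP x) => i j; rewrite (ord1 j) mxtens_indexK.
Qed.

Lemma tens_col_entry l m n (L : 'cV[C]_l) (M : 'cV[C]_m) (N : 'cV[C]_n) x y z :
  (L *t M *t N) (mxtens_index (mxtens_index (x, y), z)) 0 = L x 0 * M y 0 * N z 0.
Proof.
have := tensmxE (L *t M) N (mxtens_index (x, y)) z (mxtens_index (0, 0)) 0.
by rewrite (tensmxE L M) => <-; congr (_ _ _); apply: val_inj.
Qed.

(** * Triangle models of the three kinds of product vectors *)

Section Product.

Variables (a b c : nat) (psi : 'cV[C]_(a * b * c)).
Hypothesis psi1 : unit_vector psi.

(** [N] carries the joint factor of B and C, the other sources are trivial, and A prepares its own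
    factor: [u'] is an isometry from a one-dimensional space. *)
Lemma product_A_BC_triangle : product_A_BC psi ->
  triangle_compatible (ketbra psi).
Proof.
move=> [u [w uw]].
have [|u' [w' [u1 w1 uw']]] := @normalize_factors _ _ u w.
  rewrite -(unit_vector_tens psi1) big_distrlr /=.
  apply: eq_bigr => i _; rewrite sum_tens; do 2 apply: eq_bigr => ? _.
  by rewrite uw rmorphM mulrACA.
apply: (@pure_triangle_compatible a b c 1 1 1 1 b c (const_mx 1) (const_mx 1) w'
  (u' : 'M_(a, 1 * 1)) (rowsub (fun j => mxtens_index (0, j)) 1%:M)
  (rowsub (fun k => mxtens_index (0, k)) 1%:M)) => //.
- exact: unit_vector_const1.
- exact: unit_vector_const1.
- exact/rowsub1_isometry/mxtens_index_0l_bij.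
- exact/rowsub1_isometry/mxtens_index_0l_bij.
move=> i j k; rewrite big_ord1.
under eq_bigr do under eq_bigr do rewrite -!mulrA.
under eq_bigr do rewrite -!mulr_sumr sum_rowsub1.
rewrite -mulr_sumr sum_rowsub1.
(* The only index of A's trivial input is written as a pair so that [source_index] computes. *)
rewrite (_ : ord0 = mxtens_index (0, 0) :> 'I_(1 * 1)); last exact: val_inj.
rewrite /source_index !mxtens_indexK uw -uw' tens_col_entry !mxE !mul1r.
by congr (u' i _ * _); apply: val_inj.
Qed.

(** Here [L] carries the joint factor of A and C, and B prepares its own. *)
Lemma product_B_AC_triangle : product_B_AC psi ->
  triangle_compatible (ketbra psi).
Proof.
move=> [u [w uw]].
have [|u' [w' [u1 w1 uw']]] := @normalize_factors _ _ u w.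
  rewrite -(unit_vector_tens psi1) exchange_big big_distrlr /=.
  apply: eq_bigr => j _; rewrite sum_tens; do 2 apply: eq_bigr => ? _.
  by rewrite uw rmorphM mulrACA.
apply: (@pure_triangle_compatible a b c a c 1 1 1 1 w' (const_mx 1) (const_mx 1)
  (rowsub (fun i => mxtens_index (i, 0)) 1%:M) (u' : 'M_(b, 1 * 1))
  (rowsub (fun k => mxtens_index (k, 0)) 1%:M)) => //.
- exact: unit_vector_const1.
- exact: unit_vector_const1.
- exact/rowsub1_isometry/mxtens_index_0r_bij.
- exact/rowsub1_isometry/mxtens_index_0r_bij.
move=> i j k.
under eq_bigr do rewrite big_ord1.
under eq_bigr do under eq_bigr do rewrite -!mulrA.
under eq_bigr do rewrite -!mulr_sumr.
rewrite !sum_rowsub1.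
rewrite (_ : ord0 = mxtens_index (0, 0) :> 'I_(1 * 1)); last exact: val_inj.
rewrite /source_index !mxtens_indexK uw -uw' tens_col_entry !mxE !mulr1.
by congr (u' j _ * _); apply: val_inj.
Qed.

(** Here [M] carries the joint factor; A receives it as its second input and B as its first, hence
    the two different relabellings. *)
Lemma product_C_AB_triangle : product_C_AB psi ->
  triangle_compatible (ketbra psi).
Proof.
move=> [u [w uw]].
have [|u' [w' [u1 w1 uw']]] := @normalize_factors _ _ u w.
  rewrite -(unit_vector_tens psi1) mulrC big_distrlr sum_tens /=.
  apply: eq_bigr => i _; apply: eq_bigr => j _; apply: eq_bigr => k _.
  by rewrite uw rmorphM [RHS]mulrACA [RHS]mulrC.
apply: (@pure_triangle_compatible a b c 1 1 a b 1 1 (const_mx 1) w' (const_mx 1)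
  (rowsub (fun i => mxtens_index (0, i)) 1%:M)
  (rowsub (fun k => mxtens_index (k, 0)) 1%:M) (u' : 'M_(c, 1 * 1))) => //.
- exact: unit_vector_const1.
- exact: unit_vector_const1.
- exact/rowsub1_isometry/mxtens_index_0l_bij.
- exact/rowsub1_isometry/mxtens_index_0r_bij.
move=> i j k.
under eq_bigr do under eq_bigr do rewrite big_ord1 -!mulrA.
under eq_bigr do rewrite -!mulr_sumr sum_rowsub1.
rewrite sum_rowsub1.
rewrite (_ : ord0 = mxtens_index (0, 0) :> 'I_(1 * 1)); last exact: val_inj.
rewrite /source_index !mxtens_indexK uw -uw' tens_col_entry !mxE mul1r mulr1.
by congr (u' k _ * _); apply: val_inj.
Qed.

End Product.

End PureTriangle.

Theorem theorem1 (R : realType) (psi : 'cV[R[i]]_(2 * 2 * 2))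
    (psi_unit : unit_vector psi) :
  triangle_compatible (a := 2) (b := 2) (c := 2) (ketbra psi) <->
  product_A_BC (a := 2) (b := 2) (c := 2) psi \/
  product_B_AC (a := 2) (b := 2) (c := 2) psi \/
  product_C_AB (a := 2) (b := 2) (c := 2) psi.
Proof.
split=> [/(triangle_product psi_unit)[] | [|[]]]; first by left.
- by right; left.
- by right; right.
- exact: product_A_BC_triangle.
- exact: product_B_AC_triangle.
- exact: product_C_AB_triangle.
Qed.
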